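(* Let $f,g_i,h_j,G_l,H_l\colon\mathbb{R}^n\to\mathbb{R}$ ($i\in\mathcal M$, $j\in\mathcal P$, $l\in\mathcal Q$) be continuously differentiable, and consider the switching-constrained problem (MPSC) with feasible set $X$ and the Scholtes-type relaxed problems $(\mathrm{P}_{\mathrm S}(t))$ with feasible sets $X_{\mathrm S}(t)$, as defined in the context. Let $\{t_k\}_{k\in\mathbb{N}}\subset(0,\infty)$ be a sequence converging to $0$. For each $k\in\mathbb{N}$, let $x_k\in X_{\mathrm S}(t_k)$ be a KKT point of $(\mathrm{P}_{\mathrm S}(t_k))$. Assume that the sequence $\{x_k\}_{k\in\mathbb{N}}$ converges to a point $\bar x\in X$ where MPSC-MFCQ holds. Then $\bar x$ is a W-stationary point of (MPSC).
   Context: Index sets: $\mathcal M=\{1,\dots,m\}$, $\mathcal P=\{1,\dots,p\}$, $\mathcal Q=\{1,\dots,q\}$. (MPSC) is the problem: minimize $f(x)$ over $x\in\mathbb{R}^n$ subject to $g_i(x)\le 0$ ($i\in\mathcal M$), $h_j(x)=0$ ($j\in\mathcal P$), $G_l(x)H_l(x)=0$ ($l\in\mathcal Q$). Its feasible set is $X$. For $\bar x\in X$ put $I^g(\bar x)=\{i\in\mathcal M: g_i(\bar x)=0\}$, $I^G(\bar x)=\{l\in\mathcal Q: G_l(\bar x)=0,\ H_l(\bar x)\ne0\}$, $I^H(\bar x)=\{l\in\mathcal Q: G_l(\bar x)\neq0,\ H_l(\bar x)=0\}$, $I^{GH}(\bar x)=\{l\in\mathcal Q: G_l(\bar x)=0,\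 H_l(\bar x)=0\}$. For $t\ge0$, $(\mathrm{P}_{\mathrm S}(t))$ is the nonlinear program: minimize $f(x)$ subject to $g_i(x)\le0$ ($i\in\mathcal M$), $h_j(x)=0$ ($j\in\mathcal P$), $-t\le G_l(x)H_l(x)\le t$ ($l\in\mathcal Q$), the last constraints being understood as the two inequality constraints $G_l(x)H_l(x)-t\le0$ and $-G_l(x)H_l(x)-t\le0$ for each $l$. Its feasible set is $X_{\mathrm S}(t)$. KKT point: a feasible point of a nonlinear program with inequality constraints $c_i\le0$ and equality constraints $e_j=0$ at which there are multipliers $\lambda_i\ge0$ for the active inequality constraints and real multipliers $\rho_j$ for the equality constraints such that $\nabla f+\sum_{i\text{ active}}\lambda_i\nabla c_i+\sum_j\rho_j\nabla e_j=0$ at that point. W-stationarity: $\bar x\in X$ is W-stationary for (MPSC) if there are real multipliers $\lambda_i$ ($i\in I^g(\bar x)$), $\rho_j$ ($j\in\mathcal P$), $\mu_l,\nu_l$ ($l\in\mathcal Q$) with $0=\nabla f(\bar x)+\sum_{i\in I^g(\bar x)}\lambda_i\nabla g_i(\bar x)+\sum_{j\in\mathcal P}\rho_j\nabla h_j(\bar x)+\sum_{l\in\mathcal Q}[\mu_l\nabla G_l(\bar x)+\nu_l\nabla H_l(\bar x)]$, $\lambda_i\ge0$ for $i\in I^g(\bar x)$, $\mu_l=0$ for $l\in I^H(\bar x)$, and $\nu_l=0$ for $l\in I^G(\bar x)$. Positive-linear independence: a union $\{v^1,\dots,v^r\}\cup\{w^1,\dots,w^s\}$ of two (indexed) families of vectors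 is positive-linearly dependent if there are $\alpha\in\mathbb{R}^r$ with $\alpha\ge0$ componentwise and $\beta\in\mathbb{R}^s$, not both zero, with $\sum_i\alpha_iv^i+\sum_j\beta_jw^j=0$; otherwise it is positive-linearly independent. MPSC-MFCQ holds at $\bar x\in X$ if the union of the first family $\{\nabla g_i(\bar x): i\in I^g(\bar x)\}$ (nonnegative coefficients) with the second family $\{\nabla h_j(\bar x): j\in\mathcal P\}\cup\{\nabla G_l(\bar x): l\in I^G(\bar x)\cup I^{GH}(\bar x)\}\cup\{\nabla H_l(\bar x): l\in I^H(\bar x)\cup I^{GH}(\bar x)\}$ (free coefficients) is positive-linearly independent. *)

(* Defs.v *)
From HB Require Import structures.
From mathcomp Require Import all_boot all_order all_algebra.
From mathcomp Require Import all_classical all_reals all_analysis.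

Set Implicit Arguments.
Unset Strict Implicit.
Unset Printing Implicit Defensive.

Import Order.TTheory GRing.Theory Num.Theory.
Import numFieldNormedType.Exports.

Local Open Scope ring_scope.

Section Calculus.
Context (R : realType) (n : nat).
Implicit Types (f : 'rV[R]_n -> R) (x : 'rV[R]_n).

Definition gradient f x : 'rV[R]_n := \row_(i < n) 'D_(delta_mx 0 i) f x.

(* Frechet differentiability is required as well, because 'D has a junk value
   where the directional derivative does not exist. *)
Definition cont_diff f : Prop :=
  (forall x, differentiable f x) /\ continuous (gradient f).

End Calculus.

Section PositiveLinearIndependence.
Context (R : realType) (V : lmodType R) (I J : finType).

Definition pos_lin_dep (v : I -> V) (w : J -> V) : Prop :=
  exists (alpha : I -> R) (beta : J -> R),
    [/\ forall i, 0 <= alpha i,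
        ~ ((forall i, alpha i = 0) /\ (forall j, beta j = 0))
      & \sum_(i : I) alpha i *: v i + \sum_(j : J) beta j *: w j = 0].

Definition pos_lin_indep (v : I -> V) (w : J -> V) : Prop :=
  ~ pos_lin_dep v w.

End PositiveLinearIndependence.

(* minimize nlp_obj subject to nlp_ineq i <= 0 and nlp_eq j = 0 *)
Record nlp (R : realType) (n : nat) (I J : finType) := Nlp {
  nlp_obj : 'rV[R]_n -> R;
  nlp_ineq : I -> 'rV[R]_n -> R;
  nlp_eq : J -> 'rV[R]_n -> R }.

Section KKT.
Context (R : realType) (n : nat) (I J : finType) (N : nlp R n I J).

Definition nlp_feasible (x : 'rV[R]_n) : Prop :=
  (forall i, nlp_ineq N i x <= 0) /\ (forall j, nlp_eq N j x = 0).

Definition kkt_point (x : 'rV[R]_n) : Prop :=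
  nlp_feasible x /\
  exists (lambda : I -> R) (rho : J -> R),
    (forall i, nlp_ineq N i x = 0 -> 0 <= lambda i) /\
    gradient (nlp_obj N) x
      + \sum_(i | nlp_ineq N i x == 0) lambda i *: gradient (nlp_ineq N i) x
      + \sum_j rho j *: gradient (nlp_eq N j) x = 0.

End KKT.

(* minimize obj subject to g i <= 0, h j = 0 and G l * H l = 0 *)
Record mpsc (R : realType) (n m p q : nat) := Mpsc {
  obj : 'rV[R]_n -> R;
  g : 'I_m -> 'rV[R]_n -> R;
  h : 'I_p -> 'rV[R]_n -> R;
  G : 'I_q -> 'rV[R]_n -> R;
  H : 'I_q -> 'rV[R]_n -> R }.

Section MPSC.
Context (R : realType) (n m p q : nat) (P : mpsc R n m p q).
Implicit Types (x : 'rV[R]_n) (t : R).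

Definition mpsc_cont_diff : Prop :=
  [/\ cont_diff (obj P), forall i, cont_diff (g P i),
      forall j, cont_diff (h P j), forall l, cont_diff (G P l)
    & forall l, cont_diff (H P l)].

Definition mpsc_feasible x : Prop :=
  [/\ forall i, g P i x <= 0, forall j, h P j x = 0
    & forall l, G P l x * H P l x = 0].

Definition Ig x : {set 'I_m} := [set i | g P i x == 0]%SET.
Definition IG x : {set 'I_q} := [set l | (G P l x == 0) && (H P l x != 0)]%SET.
Definition IH x : {set 'I_q} := [set l | (G P l x != 0) && (H P l x == 0)]%SET.
Definition IGH x : {set 'I_q} := [set l | (G P l x == 0) && (H P l x == 0)]%SET.

Definition scholtes t : nlp R n ('I_m + 'I_q + 'I_q)%type 'I_p := {|
  nlp_obj := obj P;
  nlp_ineq := fun c => match c with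
    | inl (inl i) => g P i
    | inl (inr l) => fun x => G P l x * H P l x - t
    | inr l => fun x => - (G P l x * H P l x) - t
    end;
  nlp_eq := h P |}.

Definition W_stationary x : Prop :=
  mpsc_feasible x /\
  exists (lambda : 'I_m -> R) (rho : 'I_p -> R) (mu nu : 'I_q -> R),
    [/\ gradient (obj P) x
          + \sum_(i in Ig x) lambda i *: gradient (g P i) x
          + \sum_j rho j *: gradient (h P j) x
          + \sum_l (mu l *: gradient (G P l) x + nu l *: gradient (H P l) x)
        = 0,
        {in Ig x, forall i, 0 <= lambda i},
        {in IH x, forall l, mu l = 0}
      & {in IG x, forall l, nu l = 0}].

Definition MPSC_MFCQ x : Prop :=
  pos_lin_indep
    (fun i : {i | i \in Ig x} => gradient (g P (val i)) x)
    (fun c : 'I_p + {l | l \in IG x :|: IGH x} + {l | l \in IH x :|: IGH x} =>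
       match c with
       | inl (inl j) => gradient (h P j) x
       | inl (inr l) => gradient (G P (val l)) x
       | inr l => gradient (H P (val l)) x
       end).

End MPSC.

(* Main.v *)
Require Import Defs.
From mathcomp Require Import all_boot all_order all_algebra.
From mathcomp Require Import all_classical all_reals all_analysis.
Import Order.TTheory GRing.Theory Num.Theory.
Import numFieldNormedType.Exports.
Local Open Scope ring_scope.
Local Open Scope classical_set_scope.

(** The gradient of a relaxed switching constraint is, up to sign,
    [H_l grad G_l + G_l grad H_l], so the KKT conditions at [x_k] say that
    [grad f + sum_i lambda_i grad g_i + sum_j rho_j grad h_j
     + sum_l sigma_l (H_l grad G_l + G_l grad H_l)] vanishes at [x_k], where
    [sigma_l] is a real number of unknown sign ([scholtes_kkt]).

    When [l] is biactive at [xbar], both [sigma_l H_l(x_k)] and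
    [sigma_l G_l(x_k)] are free multipliers, as in MPSC-MFCQ.  When only [G_l]
    vanishes at [xbar], there is a single free multiplier [sigma_l H_l(x_k)],
    but its vector [grad G_l + (G_l / H_l) grad H_l] still tends to
    [grad G_l(xbar)], since [G_l / H_l] tends to 0; symmetrically for [H_l]
    ([switching_split], [tilted_gradient_cvg]).  The KKT conditions at [x_k]
    are therefore multiplier equations for a perturbation of the very family
    of vectors whose positive-linear independence is MPSC-MFCQ.

    It remains to pass to the limit in the multipliers.  Positive-linear
    dependence is a closed condition ([pos_lin_dep_cvg]): after normalization
    the coefficients lie in a compact set, so they converge along an
    ultrafilter, to coefficients that are again nontrivial.  Apply this to the
    family enlarged by [grad f] with coefficient 1: in the limit the
    coefficient of [grad f] is nonzero, as otherwise MPSC-MFCQ would fail, and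
    dividing by it gives the multipliers of W-stationarity
    ([pos_lin_indep_multipliers_cvg]). *)

(** * Limits of positive-linear dependence *)

Lemma ultra_cvg_compact (T : Type) (V : topologicalType) (F : set_system T)
    (f : T -> V) (A : set V) : UltraFilter F -> compact A ->
  (\forall k \near F, A (f k)) -> exists2 a, A a & f k @[k --> F] --> a.
Proof.
move=> UF cA FA; have [a [Aa aF]] := cA (f k @[k --> F]) _ FA.
exists a => // B aB; have [//|FnB] := in_ultra_setVsetC (f @^-1` B) UF.
by have [y []] := aF (~` B) B FnB aB.
Qed.

(** Dividing by the l1-norm of the coefficients makes them bounded while
    keeping track of their nontriviality through an equation. *)
Lemma pos_lin_dep_normalized (R : realType) (V : lmodType R) (I J : finType)
    (v : I -> V) (w : J -> V) : pos_lin_dep v w ->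
  exists (alpha : I -> R) (beta : J -> R),
    [/\ forall i, 0 <= alpha i,
        \sum_i `|alpha i| + \sum_j `|beta j| = 1
      & \sum_i alpha i *: v i + \sum_j beta j *: w j = 0].
Proof.
move=> [alpha [beta [alpha0 nz eq0]]].
pose s := \sum_i `|alpha i| + \sum_j `|beta j|.
have sa : 0 <= \sum_i `|alpha i| by apply: sumr_ge0.
have sb : 0 <= \sum_j `|beta j| by apply: sumr_ge0.
have s0 : 0 < s.
  rewrite lt_neqAle addr_ge0 // andbT eq_sym paddr_eq0 //; apply/negP.
  rewrite !psumr_eq0 // => /andP[/allP a0 /allP b0]; apply: nz; split=> [i|j].
  - by apply/eqP; rewrite -normr_eq0; apply: a0; rewrite mem_index_enum.
  - by apply/eqP; rewrite -normr_eq0; apply: b0; rewrite mem_index_enum.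
exists (fun i => s^-1 * alpha i), (fun j => s^-1 * beta j); split.
- by move=> i; rewrite mulr_ge0 // invr_ge0 ltW.
- under eq_bigr do rewrite normrM (gtr0_norm (x := s^-1)) ?invr_gt0 //.
  under [X in _ + X]eq_bigr do
    rewrite normrM (gtr0_norm (x := s^-1)) ?invr_gt0 //.
  by rewrite -!mulr_sumr -mulrDr mulVf // gt_eqF.
- under eq_bigr do rewrite -scalerA.
  under [X in _ + X]eq_bigr do rewrite -scalerA.
  rewrite -!scaler_sumr.
  by rewrite -scalerDr eq0 scaler0.
Qed.

Lemma cvg_sumr (R : numFieldType) (V : normedModType R) (T : Type) (I : finType)
    (F : set_system T) (f : I -> T -> V) (l : I -> V) : Filter F ->
  (forall i, f i k @[k --> F] --> l i) ->
  \sum_i f i k @[k --> F] --> \sum_i l i.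
Proof.
move=> FF fl; apply: cvg_big => //; exact: add_continuous.
Qed.

Lemma near_cst_cvg_eq (R : numFieldType) (V : normedModType R) (T : Type)
    (F : set_system T) (f : T -> V) (c l : V) : ProperFilter F ->
  (\forall k \near F, f k = c) -> f k @[k --> F] --> l -> l = c.
Proof.
move=> PF fc; apply: (closed_cvg [set c]) fc _.
by apply: accessible_closed_set1; apply: hausdorff_accessible; exact: norm_hausdorff.
Qed.

(** An ultrafilter finer than [F] replaces the successive extraction of
    subsequences: all the bounded coefficients converge along it at once.  The
    limit coefficients keep l1-norm 1, hence are nontrivial. *)
Lemma pos_lin_dep_cvg (R : realType) (V : normedModType R) (I J : finType)
    (T : Type) (F : set_system T) (v : T -> I -> V) (w : T -> J -> V)
    (v0 : I -> V) (w0 : J -> V) : ProperFilter F ->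
  (forall i, v k i @[k --> F] --> v0 i) ->
  (forall j, w k j @[k --> F] --> w0 j) ->
  (\forall k \near F, pos_lin_dep (v k) (w k)) -> pos_lin_dep v0 w0.
Proof.
move=> PF vF wF depF.
have [U [UU FU]] := ultraFilterLemma PF.
have PU : ProperFilter U by exact: ultra_proper.
have FiU : Filter U by exact: filter_filter.
have {vF} vU i : v k i @[k --> U] --> v0 i := cvg_trans (cvg_app _ FU) (vF i).
have {wF} wU j : w k j @[k --> U] --> w0 j := cvg_trans (cvg_app _ FU) (wF j).
have {depF} depU : \forall k \near U, pos_lin_dep (v k) (w k) := FU _ depF.
have exab k : exists ab : (I -> R) * (J -> R),
    pos_lin_dep (v k) (w k) ->
    [/\ forall i, 0 <= ab.1 i, \sum_i `|ab.1 i| + \sum_j `|ab.2 j| = 1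
      & \sum_i ab.1 i *: v k i + \sum_j ab.2 j *: w k j = 0].
  have [/pos_lin_dep_normalized[a [b H]]|H] := pselect (pos_lin_dep (v k) (w k)).
    by exists (a, b).
  by exists (fun=> 0, fun=> 0).
have {exab} [ab abP] := choice exab.
have {abP} abU := @filterS _ U FiU _ _ abP depU.
have le_sum (K : finType) (c : K -> R) i : `|c i| <= \sum_i `|c i|.
  by rewrite (bigD1 i) //= lerDl sumr_ge0.
have exa i : exists a : R, (ab k).1 i @[k --> U] --> a.
  have [|a _ aP] :=
    @ultra_cvg_compact _ _ U (fun k => (ab k).1 i) _ UU (@segment_compact R (-1) 1).
    apply: filterS abU => k [_ s1 _].
    rewrite /= in_itv/= -ler_norml (le_trans (le_sum _ _ _)) // -s1.
    by rewrite lerDl sumr_ge0.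
  by exists a.
have {exa} [a aP] := choice exa.
have exb j : exists b : R, (ab k).2 j @[k --> U] --> b.
  have [|b _ bP] :=
    @ultra_cvg_compact _ _ U (fun k => (ab k).2 j) _ UU (@segment_compact R (-1) 1).
    apply: filterS abU => k [_ s1 _].
    rewrite /= in_itv/= -ler_norml (le_trans (le_sum _ _ _)) // -s1.
    by rewrite lerDr sumr_ge0.
  by exists b.
have {exb} [b bP] := choice exb.
exists a, b; split.
- move=> i; apply: (closed_cvg (fun x : R => 0 <= x)) (aP i).
  + exact: closed_ge.
  + by apply: filterS abU => k [].
- (* A trivial limit would make the constant l1-norm 1 converge to 0. *)
  move=> [a0 b0].
  have : \sum_i `|(ab k).1 i| + \sum_j `|(ab k).2 j| @[k --> U]
         --> \sum_i `|a i| + \sum_j `|b j|.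
    by apply: cvgD; apply: cvg_sumr => ?; apply: cvg_norm.
  under eq_bigr do rewrite a0 normr0.
  under [X in _ + X]eq_bigr do rewrite b0 normr0.
  rewrite !big1 // addr0 => s0.
  have: (0 : R) = 1.
    by apply: near_cst_cvg_eq s0; apply: filterS abU => k [].
  by move/eqP; rewrite eq_sym oner_eq0.
- have s0 : \sum_i (ab k).1 i *: v k i + \sum_j (ab k).2 j *: w k j @[k --> U]
         --> \sum_i a i *: v0 i + \sum_j b j *: w0 j.
    by apply: cvgD; apply: cvg_sumr => ?; apply: cvgZ.
  by apply: near_cst_cvg_eq s0; apply: filterS abU => k [].
Qed.

(** A perturbed multiplier equation is a positive-linear dependence in which
    the vector [u k] joins the sign-constrained family with coefficient 1.  In
    a limit dependence its coefficient cannot vanish, by independence of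
    [v0] and [w0]. *)
Lemma pos_lin_indep_multipliers_cvg (R : realType) (V : normedModType R)
    (I J : finType) (T : Type) (F : set_system T)
    (u : T -> V) (v : T -> I -> V) (w : T -> J -> V)
    (u0 : V) (v0 : I -> V) (w0 : J -> V) : ProperFilter F ->
  pos_lin_indep v0 w0 ->
  u k @[k --> F] --> u0 ->
  (forall i, v k i @[k --> F] --> v0 i) ->
  (forall j, w k j @[k --> F] --> w0 j) ->
  (\forall k \near F, exists (alpha : I -> R) (beta : J -> R),
     (forall i, 0 <= alpha i) /\
     u k + \sum_i alpha i *: v k i + \sum_j beta j *: w k j = 0) ->
  exists (alpha : I -> R) (beta : J -> R),
    (forall i, 0 <= alpha i) /\
    u0 + \sum_i alpha i *: v0 i + \sum_j beta j *: w0 j = 0.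
Proof.
move=> PF indep uF vF wF mulF.
pose uv (a : V) (b : I -> V) (c : unit + I) := if c is inr i then b i else a.
have sum_uv a b (alpha : unit + I -> R) : \sum_c alpha c *: uv a b c =
    alpha (inl tt) *: a + \sum_i alpha (inr i) *: b i.
  by rewrite big_sumType /= (big_pred1 tt) // => -[].
have [|||alpha [beta [alpha0 nz]]] :=
    @pos_lin_dep_cvg R V (unit + I)%type J T F (fun k => uv (u k) (v k)) w
      (uv u0 v0) w0 PF.
- by case=> [[]|i] /=; [exact: uF | exact: vF].
- exact: wF.
- apply: filterS mulF => k [alpha [beta [alpha0 eq0]]].
  exists (fun c => if c is inr i then alpha i else 1), beta; split.
  + by case=> [_|i] /=; [exact: ler01 | exact: alpha0].
  + by move=> [/(_ (inl tt))/eqP]; rewrite oner_eq0.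
  + by rewrite sum_uv /= scale1r.
rewrite sum_uv; set s := alpha (inl tt) => eq0.
have s0 : s != 0.
  apply/eqP => s0; apply: indep; exists (alpha \o inr), beta; split=> //=.
    move=> [a0 b0]; apply: nz; split=> // -[[]|i]; [exact: s0 | exact: a0].
  by rewrite -[RHS]eq0 s0 scale0r add0r.
exists (fun i => s^-1 * alpha (inr i)), (fun j => s^-1 * beta j); split.
  by move=> i; rewrite mulr_ge0 // invr_ge0 alpha0.
under eq_bigr do rewrite -scalerA.
under [X in _ + X]eq_bigr do rewrite -scalerA.
rewrite -!scaler_sumr -[X in X + _ + _](scalerK s0) -!scalerDr.
by rewrite eq0 scaler0.
Qed.

(** * KKT points of the relaxed problems *)

Lemma gradientM (R : realType) (n : nat) (a b : 'rV[R]_n -> R) (x : 'rV[R]_n) :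
  differentiable a x -> differentiable b x ->
  gradient (fun y => a y * b y) x = a x *: gradient b x + b x *: gradient a x.
Proof.
move=> da db; apply/rowP => i; rewrite !mxE.
by rewrite [LHS](@deriveM _ _ a b) //; apply: diff_derivable.
Qed.

Lemma gradientBc (R : realType) (n : nat) (a : 'rV[R]_n -> R) (c : R)
    (x : 'rV[R]_n) :
  differentiable a x -> gradient (fun y => a y - c) x = gradient a x.
Proof.
move=> da; apply/rowP => i; rewrite !mxE.
by rewrite [LHS](@deriveB _ _ _ a (cst c)) ?derive_cst ?subr0 //; apply: diff_derivable.
Qed.

Lemma gradientN (R : realType) (n : nat) (a : 'rV[R]_n -> R) (x : 'rV[R]_n) :
  differentiable a x -> gradient (fun y => - a y) x = - gradient a x.
Proof.
move=> da; apply/rowP => i; rewrite !mxE.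
by rewrite [LHS](@deriveN _ _ _ a) //; apply: diff_derivable.
Qed.

(** The two one-sided relaxed constraints on [G_l H_l] have opposite gradients,
    so their multipliers combine into a signed one. *)
Lemma scholtes_kkt {R : realType} {n m p q : nat} {P : mpsc R n m p q} {t : R}
    {x : 'rV[R]_n} : mpsc_cont_diff P -> kkt_point (scholtes P t) x ->
  exists (lambda : 'I_m -> R) (rho : 'I_p -> R) (sigma : 'I_q -> R),
    [/\ forall i, 0 <= lambda i,
        forall i, g P i x != 0 -> lambda i = 0
      & gradient (obj P) x + \sum_i lambda i *: gradient (g P i) x
          + \sum_j rho j *: gradient (h P j) x
          + \sum_l sigma l *: (H P l x *: gradient (G P l) x
                               + G P l x *: gradient (H P l) x) = 0].
Proof.
move=> [_ _ _ dG dH] [_ [lam [rho [lam0 eq0]]]].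
pose act c := if nlp_ineq (scholtes P t) c x == 0 then lam c else 0.
exists (fun i => act (inl (inl i))), rho,
  (fun l => act (inl (inr l)) - act (inr l)).
split.
- by move=> i; rewrite /act; case: eqP => // /lam0.
- by move=> i; rewrite /act /= => /negPf ->.
have dGH l : differentiable (fun y => G P l y * H P l y) x.
  by apply: differentiableM; [case: (dG l)|case: (dH l)].
rewrite -[RHS]eq0 [LHS]addrAC; congr (_ + _); rewrite -addrA; congr (_ + _).
rewrite [RHS]big_mkcond !big_sumType /= -addrA; congr (_ + _).
  by apply: eq_bigr => i _; rewrite /act /=; case: ifP => // _; rewrite scale0r.
rewrite -big_split /=; apply: eq_bigr => l _.
rewrite gradientBc // gradientBc ?gradientN //; last exact: differentiableN.
rewrite gradientM; [|by case: (dG l)|by case: (dH l)].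
rewrite scalerBl -scalerN [_ *: _ + G _ _ _ *: _]addrC /act /=.
by case: ifP => _; case: ifP => _; rewrite ?scale0r.
Qed.

(** * Switching constraints near the limit point *)

(** For a switching pair with [a xbar = 0] and [b xbar != 0], the gradient of
    [a * b] divided by [b], a perturbation of [gradient a xbar]; at a biactive
    pair, the plain gradient of [a]. *)
Definition tilted_gradient {R : realType} {n : nat} (a b : 'rV[R]_n -> R)
    (xbar x : 'rV[R]_n) : 'rV[R]_n :=
  gradient a x + (if b xbar == 0 then 0 else a x / b x) *: gradient b x.

Lemma tilted_gradient_cvg (R : realType) (n : nat) (a b : 'rV[R]_n -> R)
    (T : Type) (F : set_system T) (x : T -> 'rV[R]_n) (xbar : 'rV[R]_n) :
  Filter F -> cont_diff a -> cont_diff b -> a xbar = 0 ->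
  x k @[k --> F] --> xbar ->
  tilted_gradient a b xbar (x k) @[k --> F] --> gradient a xbar.
Proof.
move=> FF [da ca] [db cb] a0 xF.
have -> : gradient a xbar = gradient a xbar + 0 *: gradient b xbar.
  by rewrite scale0r addr0.
apply: cvgD; first exact: continuous_cvg (ca xbar) xF.
apply: cvgZ; last exact: continuous_cvg (cb xbar) xF.
case: eqP => [_|/eqP b0]; first exact: cvg_cst.
rewrite -(mul0r (b xbar)^-1) -a0.
apply: cvgM; first exact: continuous_cvg (differentiable_continuous (da xbar)) xF.
by apply: cvgV => //; exact: continuous_cvg (differentiable_continuous (db xbar)) xF.
Qed.

(** The test in each summand says whether the constraint class at [xbar]
    allows that multiplier, so the right-hand side has exactly the free
    multipliers of MPSC-MFCQ. *)
Lemma switching_split {R : realType} {n : nat} {a b : 'rV[R]_n -> R}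
    {xbar x : 'rV[R]_n} (s : R) : a xbar * b xbar = 0 ->
  (a xbar != 0 -> a x != 0) -> (b xbar != 0 -> b x != 0) ->
  s *: (b x *: gradient a x + a x *: gradient b x) =
    (if a xbar == 0 then (s * b x) *: tilted_gradient a b xbar x else 0)
    + (if b xbar == 0 then (s * a x) *: tilted_gradient b a xbar x else 0).
Proof.
move=> /eqP; rewrite mulf_eq0 /tilted_gradient scalerDr !scalerA.
have [a0|_] /= := eqVneq (a xbar); have [b0|_] //= := eqVneq (b xbar).
- by rewrite !scale0r !addr0.
- move=> _ _ /(_ isT) bx; rewrite addr0 scalerDr scalerA; congr (_ + _ *: _).
  by rewrite mulrAC -mulrA mulfVK // mulrC.
- move=> _ /(_ isT) ax _; rewrite add0r scalerDr scalerA addrC; congr (_ + _ *: _).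
  by rewrite -mulrA [a x * _]mulrC mulfVK.
Qed.

Lemma mem_IG_IGH (R : realType) (n m p q : nat) (P : mpsc R n m p q)
    (x : 'rV[R]_n) l : (l \in IG P x :|: IGH P x) = (G P l x == 0).
Proof. by rewrite !inE -andb_orr orNb andbT. Qed.

Lemma mem_IH_IGH (R : realType) (n m p q : nat) (P : mpsc R n m p q)
    (x : 'rV[R]_n) l : (l \in IH P x :|: IGH P x) = (H P l x == 0).
Proof. by rewrite !inE -andb_orl orNb. Qed.

(** * Multipliers indexed by subsets *)

Definition extend0 {R : realType} {I : finType} {A : {set I}}
    (c : {i | i \in A} -> R) (i : I) : R := oapp c 0 (insub i).

Lemma extend0_out (R : realType) (I : finType) (A : {set I})
    (c : {i | i \in A} -> R) i : i \notin A -> extend0 c i = 0.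
Proof. by move=> iA; rewrite /extend0 insubN. Qed.

Lemma sum_extend0 (R : realType) (V : lmodType R) (I : finType) (A : {set I})
    (c : {i | i \in A} -> R) (v : I -> V) :
  \sum_(i in A) extend0 c i *: v i = \sum_u c u *: v (val u).
Proof. by rewrite big_sub; apply: eq_bigr => u _; rewrite /extend0 valK. Qed.

Lemma sum_extend0_all (R : realType) (V : lmodType R) (I : finType) (A : {set I})
    (c : {i | i \in A} -> R) (v : I -> V) :
  \sum_i extend0 c i *: v i = \sum_u c u *: v (val u).
Proof.
rewrite -sum_extend0 [RHS]big_mkcond; apply: eq_bigr => i _.
by case: ifPn => // iA; rewrite extend0_out // scale0r.
Qed.

(** * W-stationarity of the limit *)

Theorem theorem4p1 (R : realType) (n m p q : nat) (P : mpsc R n m p q)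
    (t : nat -> R) (x : nat -> 'rV[R]_n) (xbar : 'rV[R]_n) :
  mpsc_cont_diff P ->
  (forall k, 0 < t k) ->
  t @ \oo --> (0 : R) ->
  (forall k, nlp_feasible (scholtes P (t k)) (x k)) ->
  (forall k, kkt_point (scholtes P (t k)) (x k)) ->
  x @ \oo --> xbar ->
  mpsc_feasible P xbar ->
  MPSC_MFCQ P xbar ->
  W_stationary P xbar.
Proof.
move=> CD _ _ _ kkt xcvg feas mfcq; split=> //.
have [cf cg ch cG cH] := CD; have [_ _ GH0] := feas.
have near0 (a : 'rV[R]_n -> R) : cont_diff a ->
    \forall k \near \oo, a xbar != 0 -> a (x k) != 0.
  move=> [da _]; have [_|a0] := eqVneq (a xbar) 0; first exact: nearW.
  have : \forall k \near \oo, a (x k) != 0.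
    apply: cvgr_neq0 a0.
    exact: continuous_cvg (differentiable_continuous (da xbar)) xcvg.
  by apply: filterS.
have grad_cvg (a : 'rV[R]_n -> R) : cont_diff a ->
    gradient a (x k) @[k --> \oo] --> gradient a xbar.
  by move=> [_ ca]; exact: continuous_cvg (ca xbar) xcvg.
have [||||alpha [beta [alpha0 eq0]]] :=
  @pos_lin_indep_multipliers_cvg R 'rV[R]_n _ _ nat \oo
    (fun k => gradient (obj P) (x k))
    (fun k (i : {i | i \in Ig P xbar}) => gradient (g P (val i)) (x k))
    (fun k (c : 'I_p + {l | l \in IG P xbar :|: IGH P xbar}
                + {l | l \in IH P xbar :|: IGH P xbar}) =>
       match c with
       | inl (inl j) => gradient (h P j) (x k)
       | inl (inr l) =>
           tilted_gradient (G P (val l)) (H P (val l)) xbar (x k)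
       | inr l => tilted_gradient (H P (val l)) (G P (val l)) xbar (x k)
       end) (gradient (obj P) xbar) _ _ _ mfcq.
- exact: grad_cvg.
- by move=> i; exact: grad_cvg.
- move=> [[j|[l]]|[l]] /=; first exact: grad_cvg.
  + by rewrite mem_IG_IGH => /eqP Gl; exact: tilted_gradient_cvg.
  + by rewrite mem_IH_IGH => /eqP Hl; exact: tilted_gradient_cvg.
- have gk : \forall k \near \oo, forall i, g P i xbar != 0 -> g P i (x k) != 0.
    by apply: filter_forall => i; exact: near0.
  have Gk : \forall k \near \oo, forall l, G P l xbar != 0 -> G P l (x k) != 0.
    by apply: filter_forall => l; exact: near0.
  have Hk : \forall k \near \oo, forall l, H P l xbar != 0 -> H P l (x k) != 0.
    by apply: filter_forall => l; exact: near0.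
  apply: filterS3 gk Gk Hk => k gk Gk Hk.
  have [lam [rho [sigma [lam0 lam_inact eq0]]]] := scholtes_kkt CD (kkt k).
  (* The g_i inactive at xbar stay inactive at x_k, so that lam vanishes on
     them and restricting it to the active indices loses nothing. *)
  exists (lam \o val), (fun c => match c with
     | inl (inl j) => rho j
     | inl (inr l) => sigma (val l) * H P (val l) (x k)
     | inr l => sigma (val l) * G P (val l) (x k)
     end); split=> [i|]; first exact: lam0.
  rewrite -[RHS]eq0 !big_sumType /= !addrA -!addrA; congr (_ + (_ + (_ + _))).
  + rewrite -(big_sub _ (fun i => lam i *: gradient (g P i) (x k))) big_mkcond /=.
    apply: eq_bigr => i _; rewrite inE; case: ifPn => // /gk/lam_inact ->.
    by rewrite scale0r.
  + under [RHS]eq_bigr => l _ do rewrite (switching_split _ (GH0 l) (Gk l) (Hk l)).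
    rewrite big_split /= -!big_mkcond /=.
    rewrite -(big_sub _ (fun l => (sigma l * H P l (x k)) *:
                            tilted_gradient (G P l) (H P l) xbar (x k))).
    rewrite -(big_sub _ (fun l => (sigma l * G P l (x k)) *:
                            tilted_gradient (H P l) (G P l) xbar (x k))).
    by congr (_ + _); apply: eq_bigl => l; rewrite ?mem_IG_IGH ?mem_IH_IGH.
exists (extend0 alpha), (beta \o inl \o inl), (extend0 (beta \o inl \o inr)),
  (extend0 (beta \o inr)); split.
- by rewrite -[RHS]eq0 !big_sumType /= sum_extend0 big_split /= !sum_extend0_all !addrA.
- by move=> i _; rewrite /extend0; case: insub => //= u; exact: alpha0.
- by move=> l; rewrite inE => /andP[Gl _]; rewrite extend0_out // mem_IG_IGH.
- by move=> l; rewrite inE => /andP[_ Hl]; rewrite extend0_out // mem_IH_IGH.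
Qed.
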